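(* There exists an absolute constant $c>0$ such that the following holds. Let $d\ge1$ be an integer, let $P(x)=\sum_{k=0}^d b_kx^k$ be a real valued polynomial of degree at most $d$ in one real variable, let $\alpha>0$, and let $M=\max\{|b_k|:\frac d2<k\le d\}$, where $M>0$. If $E=\{x\ge1:|P(x)|\le\alpha\}$, then $$\int_E\frac{dx}{x}\le c\,\min\left(\left(\frac{\alpha}{M}\right)^{\frac1d},\ 1+\frac1d\log^+\frac{\alpha}{M}\right).$$
   Context: $\log^+t=\max(\log t,0)$ for $t>0$. ''Absolute constant'' means that $c$ does not depend on $d$, $P$ or $\alpha$. *)

(* Defs.v *)
From HB Require Import structures.
From mathcomp Require Import all_boot all_order all_algebra.
From mathcomp Require Import all_classical all_reals all_analysis.
Set Implicit Arguments.
Unset Strict Implicit.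
Unset Printing Implicit Defensive.
Import Order.TTheory GRing.Theory Num.Theory.
Import numFieldNormedType.Exports.
Local Open Scope classical_set_scope.
Local Open Scope ring_scope.

Definition logp (R : realType) (t : R) : R := Num.max (ln t) 0.

(* [(d < k.*2)%N] is d/2 < k over the reals. For d >= 1 the index k = d
   qualifies, so the default value 0 does not affect the maximum. *)
Definition max_top_coef (R : realType) (d : nat) (P : {poly R}) : R :=
  \big[Num.max/0]_(k < d.+1 | (d < k.*2)%N) `|P`_k|.

Definition sublevel_ge1 (R : realType) (P : {poly R}) (alpha : R) : set R :=
  [set x | 1 <= x /\ `|P.[x]| <= alpha].

(* Main.v *)
Require Import Defs.
From mathcomp Require Import all_boot all_order all_algebra.
From mathcomp Require Import all_classical all_reals all_analysis.
From mathcomp Require Import measurable_realfun.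
From mathcomp Require Import zify ring lra.
Set Implicit Arguments.
Unset Strict Implicit.
Unset Printing Implicit Defensive.
Import Order.TTheory GRing.Theory Num.Theory.
Import numFieldNormedType.Exports.
Local Open Scope classical_set_scope.
Local Open Scope ring_scope.

(** Write t = (alpha / M)^(1/d), and measure sets of x >= 1 by dx/x.

A set of large logarithmic measure contains many geometrically spread points:
given delta > 0, pick greedily the least point of E beyond e^delta, then the
least point beyond e^delta times the previous one, and so on. If the search
stops before d + 1 points are found, then E is covered by d + 1 intervals
[y, e^delta y], each of logarithmic measure delta, so the integral is at most
s = (d + 1) delta ([geom_points_or_small_log_measure]).

If it succeeds, Lagrange interpolation at the points x_0 < ... < x_d recovers
every coefficient b_k from values of P bounded by alpha. Dividing each factor
of a Lagrange polynomial by its node,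
  (X - x_i) / (x_j - x_i) = (x_i / (x_j - x_i)) (X / x_i - 1),
separates two effects. The first factors only depend on the gaps: since
|x_j - x_i| >= x_i (1 - e^(-|i-j| delta)), their product is at most
(C (1 + 1/s))^d ([prod_ratio_bound]). In the product of the X / x_i - 1, the
coefficient of X^k is a sum over k-element sets J of products of 1/x_i for i
in J, and x_i >= e^((i+1) delta) makes each of them at most
e^(- delta k^2 / 2). This is at most e^(- s d / 8) when k > d/2, which is where
the restriction to the top half of the coefficients enters
([norm_coef_node_bound]).

Hence M <= alpha (16 e^2 (1 + 1/s) e^(-s/8))^d ([top_coef_bound]), that is,
e^(s/8) <= 16 e^2 t (1 + 1/s). This forces s to be at most a constant times t,
and, if s >= 1, at most a constant times 1 + log^+ t ([exp_growth_bounds]).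
Taking for s a larger multiple of the minimum of these two quantities, the
greedy search cannot succeed, and so the integral is at most s. *)

(** * Counting estimates for the node indices *)

(** Among the pairs in J x J, at most i + 1 have first component i and second
component at most i; up to exchanging the components, this covers all pairs. *)
Lemma leq_sqr_card_sum (n : nat) (J : {set 'I_n}) :
  (#|J| ^ 2 <= 2 * \sum_(i in J) i.+1)%N.
Proof.
have -> : (#|J| ^ 2 = \sum_(i in J) \sum_(j in J) 1)%N.
  by rewrite sum1_card sum_nat_const mulnn.
apply: (@leq_trans (\sum_(i in J) \sum_(j in J) ((j <= i) + (i <= j))))%N.
  by apply: leq_sum => i _; apply: leq_sum => j _; lia.
under eq_bigr do rewrite big_split /=.
rewrite big_split /= [X in (_ + X)%N]exchange_big /= addnn -mul2n leq_mul2l /=.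
apply: leq_sum => i _.
apply: (@leq_trans (\sum_(j < n) (j < i.+1)))%N.
  by rewrite [leqRHS](bigID (mem J)) /= leq_addr.
rewrite -(big_mkord xpredT (fun j => (j < i.+1)%N : nat)).
rewrite (big_cat_nat (n := i.+1)) //= big_nat [X in (_ + X)%N]big_nat.
rewrite (eq_bigr (fun=> 1%N)) => [|j /andP[_ ->] //].
rewrite [X in (_ + X)%N]big1 ?addn0 => [|j /andP[+ _]]; last by lia.
by rewrite -big_nat sum_nat_const_nat muln1 subn0.
Qed.

(** With truncated subtraction, (i - j) + (j - i) is the distance |i - j|. *)
Lemma prod_dist_fact (d j : nat) : (j <= d)%N ->
  (\prod_(i < d.+1 | i != j :> nat) ((i - j) + (j - i)) = j`! * (d - j)`!)%N.
Proof.
move=> jd.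
rewrite -(big_mkord (fun i => i != j) (fun i => ((i - j) + (j - i))%N)).
rewrite (big_cat_nat (n := j)) //=; last exact: leqW.
congr (_ * _)%N.
  rewrite big_mkcond big_nat_rev /= fact_prod -(@prednK j.+1) // big_add1 /=.
  rewrite !big_nat; apply: eq_bigr => i /andP[_ ij].
  rewrite ifT; last by lia.
  lia.
rewrite big_ltn_cond //= eqxx /= -[j.+1]addn1 addnC.
rewrite fact_prod -(@prednK d.+1) // -{1}(subnK jd) -addSn.
rewrite big_addn addnK [LHS]big_mkcond !big_nat /=.
apply: eq_bigr => i /andP[i0 _]; rewrite ifT; lia.
Qed.

Lemma leq_bin_exp2 (d j : nat) : ('C(d, j) <= 2 ^ d)%N.
Proof.
have <- : #|{set 'I_d}| = (2 ^ d)%N.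
  by rewrite -cardsT -powersetT card_powerset cardsT card_ord.
rewrite -[d in 'C(d, _)]card_ord -card_draws.
exact: max_card.
Qed.

(** The quotient is C(d, j) (d+1)^d / d!, and (d+1)^d / d! is a term of the
exponential series at d + 1. *)
Lemma expn_fact_dist_bound (R : realType) (d j : nat) : (0 < d)%N -> (j <= d)%N ->
  d.+1%:R ^+ d / (j`! * (d - j)`!)%:R <= 2 ^+ d * expR d.+1%:R :> R.
Proof.
move=> d0 jd.
have f0 n : (0 : R) < n`!%:R by rewrite ltr0n fact_gt0.
have fE : d`!%:R = 'C(d, j)%:R * (j`! * (d - j)`!)%:R :> R.
  by rewrite -natrM bin_fact.
have -> : d.+1%:R ^+ d / (j`! * (d - j)`!)%:R = 'C(d, j)%:R * (d.+1%:R ^+ d / d`!%:R) :> R.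
  rewrite fE invfM mulrCA mulVKf //.
  by rewrite pnatr_eq0 -lt0n bin_gt0.
apply: ler_pM => //.
- by rewrite -natrX ler_nat leq_bin_exp2.
- apply: le_trans (_ : 1 + d.+1%:R ^+ d / d`!%:R <= _); first by rewrite lerDr.
  by case: d d0 {jd fE} => // d _; exact: expR_ge1Dxn.
Qed.

(** * Coefficients of a product of linear factors *)

(** Expanding the product over subsets J of the indices, only those with k
elements contribute to the coefficient of X^k, each by a product of a_i up to
sign, and there are at most 2^|I| of them. *)
Lemma norm_coef_prod_scaleX_sub1 (R : realType) (I : finType) (a : I -> R)
    (k : nat) (B : R) : 0 <= B ->
  (forall J : {set I}, #|J| = k -> \prod_(i in J) `|a i| <= B) ->
  `|(\prod_i (a i *: 'X - 1))`_k| <= 2 ^+ #|I| * B.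
Proof.
move=> B0 aB; rewrite bigA_distr coef_sum.
apply: le_trans (ler_norm_sum _ _ _) _.
have -> : 2 ^+ #|I| * B = \sum_(J in {set I}) B.
  rewrite sumr_const -[B *+ _]mulr_natl -natrX; congr (_%:R * _).
  by rewrite -(cardsT I) -card_powerset powersetT cardsT.
apply: ler_sum => J _.
have -> : \prod_i (if i \in J then a i *: 'X else -1)
    = ((\prod_(i in J) a i) * (-1) ^+ #|~: J|) *: 'X^#|J| :> {poly R}.
  rewrite (bigID (mem J)) /=.
  rewrite (eq_bigr (fun i => a i *: 'X)); last by move=> i ->.
  rewrite [X in _ * X](eq_bigr (fun=> -1)); last by move=> i /negbTE ->.
  rewrite scaler_prod !prodr_const -scalerA.
  rewrite (_ : #|[pred i | i \notin J]| = #|~: J|); last first.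
    by apply: eq_card => i; rewrite !inE.
  rewrite -scalerAl mulrC; congr (_ *: _).
  by rewrite -[in LHS]signr_odd mulr_sign -[in RHS]signr_odd scaler_sign.
rewrite coefZ coefXn normrM normrM normrX normrN1 expr1n mulr1 normr_prod.
case: eqP => [/esym kJ|_]; first by rewrite normr1 mulr1 aB.
by rewrite normr0 mulr0.
Qed.

(** * Geometrically separated points *)
(** The sequence is infinite even where only finitely many of its terms matter:
it is then injective on all naturals, as Lagrange interpolation requires. *)
Definition geom_separated (R : realType) (q : R) (x : nat -> R) : Prop :=
  forall i, q * x i <= x i.+1.

Lemma geom_separatedX (R : realType) (q : R) (x : nat -> R) : 0 <= q ->
  geom_separated q x -> forall i n, q ^+ n * x i <= x (i + n)%N.
Proof.
move=> q0 xq i; elim=> [|n IH]; first by rewrite addn0 mul1r.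
by rewrite addnS exprS -mulrA (le_trans _ (xq _)) // ler_wpM2l.
Qed.

(** If n = |i - j|, the larger of the two points is at least q^n times the
smaller one, so |x_j - x_i| >= x_i (1 - q^(-n)). Since q^n >= 1 + n delta, this
is at least x_i n delta / (1 + n delta), whose inverse gives the bound. *)
Lemma geom_separated_ratio (R : realType) (delta : R) (x : nat -> R) (i j : nat) :
  0 < delta -> (forall i, 0 < x i) -> geom_separated (expR delta) x -> i != j ->
  x i / `|x j - x i| <= 1 + (((i - j) + (j - i))%:R * delta)^-1.
Proof.
move=> delta0 x0 xq ij.
set n := ((i - j) + (j - i))%N.
have n0 : (0 : R) < n%:R by rewrite ltr0n /n; lia.
have nd0 : 0 < n%:R * delta by rewrite mulr_gt0.
set q := expR delta in xq *.
have q0 : 0 <= q by exact: expR_ge0.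
have qn1 : 1 + n%:R * delta <= q ^+ n.
  by rewrite /q -expRM_natl expR_ge1Dx.
have qn0 : 0 < q ^+ n by lra.
have e : 1 + (n%:R * delta)^-1 = ((n%:R * delta) / (1 + n%:R * delta))^-1.
  by rewrite invf_div mulrDl mul1r mulfV ?lt0r_neq0 // addrC.
suff : x i * ((n%:R * delta) / (1 + n%:R * delta)) <= `|x j - x i|.
  move=> h; have r0 : 0 < n%:R * delta / (1 + n%:R * delta).
    by rewrite divr_gt0 //; lra.
  have d0 : 0 < `|x j - x i| by apply: lt_le_trans h; rewrite mulr_gt0.
  by rewrite e ler_pdivrMr // mulrC ler_pdivlMr.
have [ltij|geij] := ltnP i j.
- have := geom_separatedX q0 xq i n; rewrite (_ : (i + n = j)%N); last by rewrite /n; lia.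
  move=> xj; apply: le_trans (ler_norm _).
  have : (1 + n%:R * delta) * x i <= q ^+ n * x i by rewrite ler_wpM2r // ltW.
  have : x i * (n%:R * delta / (1 + n%:R * delta)) <= x i * (n%:R * delta).
    rewrite ler_wpM2l ?(ltW (x0 i)) // ler_pdivrMr; last by lra.
    by rewrite ler_peMr //; lra.
  lra.
- have := geom_separatedX q0 xq j n; rewrite (_ : (j + n = i)%N); last by rewrite /n; lia.
  move=> xi; rewrite distrC; apply: le_trans (ler_norm _).
  have h : (1 + n%:R * delta) * x j <= x i.
    by apply: le_trans xi; rewrite ler_wpM2r // ltW.
  have {h} : x j <= x i / (1 + n%:R * delta).
    by rewrite ler_pdivlMr 1?mulrC //; lra.
  have : x i * (n%:R * delta / (1 + n%:R * delta)) = x i - x i / (1 + n%:R * delta).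
    by field; apply: lt0r_neq0; lra.
  lra.
Qed.

(** * Bounding the top coefficients by interpolation *)

(** As |i - j| <= d + 1, each factor 1 + 1 / (|i - j| delta) is at most
((d + 1) / |i - j|) (1 + 1 / ((d + 1) delta)). The distances then only enter
through the product of the |i - j|, which is j! (d - j)!. *)
Lemma prod_ratio_bound (R : realType) (delta : R) (x : nat -> R) (d : nat)
    (j : 'I_d.+1) : (0 < d)%N ->
  0 < delta -> (forall i, 0 < x i) -> geom_separated (expR delta) x ->
  \prod_(i < d.+1 | i != j) (x i / `|x j - x i|)
    <= 2 ^+ d * expR d.+1%:R * (1 + (d.+1%:R * delta)^-1) ^+ d.
Proof.
move=> d0 delta0 x0 xq.
pose n (i : nat) := ((i - j) + (j - i))%N.
have s0 : 0 < d.+1%:R * delta by rewrite mulr_gt0.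
have card_neq : #|[pred i | i != j]| = d by rewrite cardC1 card_ord.
apply: (@le_trans _ _ (\prod_(i < d.+1 | i != j)
    (d.+1%:R * (1 + (d.+1%:R * delta)^-1) / (n i)%:R))).
  apply: ler_prod => i ij; rewrite divr_ge0 ?normr_ge0 ?(ltW (x0 _)) //=.
  have ij' : i != j :> nat by [].
  have n0 : (0 : R) < (n i)%:R.
    by rewrite ltr0n /n; move: (ij'); lia.
  have nd : (n i)%:R <= d.+1%:R :> R.
    by rewrite ler_nat /n; have := ltn_ord i; have := ltn_ord j; lia.
  apply: le_trans (geom_separated_ratio delta0 x0 xq ij') _.
  rewrite mulrDr mulr1 mulrDl lerD //; first by rewrite ler_pdivlMr // mul1r.
  by rewrite invfM -/(n i) invfM mulVKf // mulrC.
rewrite big_split /= prodr_const card_neq exprMn prodfV -natr_prod.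
rewrite (prod_dist_fact (leq_ord j)).
rewrite mulrAC ler_wpM2r ?exprn_ge0 ?addr_ge0 ?invr_ge0 ?(ltW s0) //.
exact: (expn_fact_dist_bound R d0 (leq_ord j)).
Qed.

(** After factoring out the nodes, the coefficient is controlled by the
products of 1 / x_i over k-element sets J, where x_i >= e^((i+1) delta). The sum
of the i + 1 over J is at least k^2 / 2, hence at least (d + 1)^2 / 8 because
2 k >= d + 1. *)
Lemma norm_coef_node_bound (R : realType) (delta : R) (x : nat -> R) (d k : nat)
    (j : 'I_d.+1) : (d < k.*2)%N ->
  0 < delta -> expR delta <= x 0%N -> geom_separated (expR delta) x ->
  `|(\prod_(i < d.+1 | i != j) ('X - (x i)%:P))`_k|
    <= 2 ^+ d.+1 * expR (- (d.+1%:R * delta / 8)) ^+ d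
       * \prod_(i < d.+1 | i != j) x i.
Proof.
move=> dk delta0 xx0 xq.
have xge i : expR delta ^+ i.+1 <= x i.
  have := geom_separatedX (expR_ge0 _) xq 0%N i; rewrite add0n; apply: le_trans.
  by rewrite exprSr ler_wpM2l // exprn_ge0 // expR_ge0.
have x0 i : 0 < x i by apply: lt_le_trans (xge i); rewrite exprn_gt0 // expR_gt0.
(* The value 0 at j turns the missing factor of index j into the constant -1,
   so that the product runs over all indices. *)
pose a (i : 'I_d.+1) := if i == j then 0 else (x i)^-1.
have -> : \prod_(i < d.+1 | i != j) ('X - (x i)%:P)
    = - (\prod_(i < d.+1 | i != j) x i) *: \prod_(i < d.+1) (a i *: 'X - 1).
  rewrite [\prod_(i < d.+1) (a i *: 'X - 1)](bigD1 j) //= /a eqxx scale0r sub0r.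
  rewrite mulN1r scalerN scaleNr opprK -scaler_prod.
  apply: eq_bigr => i /negbTE ->.
  by rewrite scalerBr scalerA mulfV ?lt0r_neq0 // scale1r alg_polyC.
rewrite coefZ normrM normrN mulrC [`|\prod_(i < _ | _) _|]ger0_norm; last first.
  by apply: prodr_ge0 => i _; exact: ltW.
apply: ler_wpM2r; first by apply: prodr_ge0 => i _; exact: ltW.
have := norm_coef_prod_scaleX_sub1 (a := a) (k := k)
  (B := expR (- (d.+1%:R * delta / 8)) ^+ d).
rewrite card_ord; apply.
  by rewrite exprn_ge0 // expR_ge0.
move=> J Jk.
apply: (@le_trans _ _ (\prod_(i in J) (expR delta ^+ i.+1)^-1)).
  apply: ler_prod => i _; rewrite normr_ge0 /= /a; case: eqP => _.
    by rewrite normr0 invr_ge0 exprn_ge0 // expR_ge0.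
  rewrite ger0_norm ?invr_ge0 ?(ltW (x0 _)) // lef_pV2 ?posrE ?xge ?x0 //.
  by rewrite exprn_gt0 // expR_gt0.
rewrite prodfV prodrXr -!expRM_natl -expRN ler_expR.
have := leq_sqr_card_sum J; rewrite Jk => kJ.
have : (d.+1 ^ 2 <= 8 * \sum_(i in J) i.+1)%N.
  have : (d.+1 ^ 2 <= (2 * k) ^ 2)%N by rewrite leq_exp2r //; lia.
  by move/leq_trans; apply; rewrite expnMn -[8%N]/(2 ^ 2 * 2)%N -mulnA leq_mul2l.
rewrite -(ler_nat R) natrX natrM => h.
set S := (\sum_(i in J) i.+1)%N in h *.
rewrite mulrN lerN2 -subr_ge0.
have := ler_wpM2r (ltW delta0) h.
have dd : d%:R <= d.+1%:R :> R by rewrite ler_nat.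
have : d%:R * (d.+1%:R * delta) <= d.+1%:R * (d.+1%:R * delta).
  by rewrite ler_wpM2r // mulr_ge0 // ltW.
by rewrite expr2; lra.
Qed.

Lemma top_coef_bound (R : realType) (P : {poly R}) (alpha delta : R) (x : nat -> R)
    (d k : nat) : (0 < d)%N -> (size P <= d.+1)%N -> (d < k.*2)%N ->
  0 < delta -> expR delta <= x 0%N -> geom_separated (expR delta) x ->
  (forall i, (i <= d)%N -> `|P.[x i]| <= alpha) ->
  `|P`_k| <= alpha * (16 * expR 2 * (1 + (d.+1%:R * delta)^-1)
                      * expR (- (d.+1%:R * delta / 8))) ^+ d.
Proof.
move=> d0 sP dk delta0 xx0 xq Px; set s := d.+1%:R * delta.
have q1 : 1 < expR delta by rewrite expR_gt1.
have x0 i : 0 < x i.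
  elim: i => [|i IH]; first by apply: lt_le_trans xx0; exact: expR_gt0.
  by apply: lt_le_trans (xq i); rewrite mulr_gt0 // expR_gt0.
have x_incr : {homo x : i j / (i < j)%N >-> i < j}.
  apply: homo_ltn; first exact: lt_trans.
  by move=> i; apply: lt_le_trans (xq i); rewrite ltr_pMl.
have x_inj : injective x.
  by move=> i j xij; case: (ltngtP i j) => // /x_incr; rewrite xij ltxx.
have s0 : 0 < s by rewrite mulr_gt0.
have alpha0 : 0 <= alpha by apply: le_trans (Px 0%N _).
pose T := 2 ^+ d * expR d.+1%:R * (1 + s^-1) ^+ d.
pose B := 2 ^+ d.+1 * expR (- (s / 8)) ^+ d.
have B0 : 0 <= B by rewrite mulr_ge0 ?exprn_ge0 ?expR_ge0.
have T0 : 0 <= T.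
  by rewrite !mulr_ge0 ?exprn_ge0 ?expR_ge0 ?addr_ge0 ?invr_ge0 ?(ltW s0).
apply: (@le_trans _ _ (\sum_(j < d.+1) alpha * (T * B))).
  rewrite {1}(lagrange_gen (ltn0Sn d) x_inj sP) coef_sum.
  apply: le_trans (ler_norm_sum _ _ _) _; apply: ler_sum => j _.
  rewrite coefCM lagrangeE // coefCM !normrM ler_pM //; first exact/Px/leq_ord.
  rewrite normfV horner_prod normr_prod.
  have h := norm_coef_node_bound j dk delta0 xx0 xq.
  apply: le_trans (ler_wpM2l _ h) _; first by rewrite invr_ge0 prodr_ge0.
  rewrite mulrCA mulrA -/s -/B (mulrC T B) -mulrA ler_wpM2l //.
  rewrite -prodfV -big_split /= (eq_bigr (fun i : 'I_d.+1 => x i / `|x j - x i|)).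
    exact: prod_ratio_bound.
  by move=> i _; rewrite hornerXsubC mulrC.
rewrite sumr_const card_ord -[_ *+ _]mulr_natl mulrCA ler_wpM2l //.
have -> : d.+1%:R * (T * B) = d.+1%:R * 2 ^+ d * 2 ^+ d.+1 * expR d.+1%:R
   * ((1 + s^-1) * expR (- (s / 8))) ^+ d by rewrite /T /B exprMn; ring.
(* The d + 1 nodes and the powers of 2 and e are absorbed into (16 e^2)^d. *)
rewrite -[in leRHS]mulrA [leRHS]exprMn ler_wpM2r ?exprn_ge0 ?mulr_ge0
  ?expR_ge0 ?addr_ge0 ?invr_ge0 ?(ltW s0) //.
rewrite exprMn ler_pM ?expR_ge0 //.
  rewrite (_ : 16 = 2 ^+ 4); last by ring.
  rewrite -exprM -!natrX -!natrM ler_nat.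
  apply: (@leq_trans (2 ^ d * 2 ^ d * 2 ^ d.+1)).
    by rewrite !leq_mul2r ltn_expl // !orbT.
  by rewrite -!expnD leq_exp2l //; lia.
rewrite -expRM_natl ler_expR -natrM ler_nat; lia.
Qed.

(** * The greedy choice of points *)

Lemma closed_has_min (R : realType) (A : set R) : closed A -> A !=set0 ->
  has_lbound A -> exists2 m, A m & forall x, A x -> m <= x.
Proof.
move=> cA A0 lA; exists (inf A); last by move=> x; exact: ge_inf.
apply: (itv_closed_infimums A0 cA); split; first by move=> x; exact: ge_inf.
by move=> x; exact: lb_le_inf.
Qed.

Lemma measurable_inv_ge1 (R : realType) (A : set R) :
  measurable A -> (forall x, A x -> 1 <= x) ->
  measurable_fun A (fun x : R => (x^-1)%:E).
Proof.
move=> mA A1; apply/measurable_EFinP.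
have mi := measurable_itv (`]0, +oo[ : interval R).
apply: (measurable_funS mi).
  by move=> x /A1 x1; rewrite /= in_itv /= andbT (lt_le_trans ltr01).
apply: open_continuous_measurable_fun; first exact: interval_open.
move=> x; rewrite inE /= in_itv /= andbT => x0.
by apply: inv_continuous; rewrite gt_eqF.
Qed.

Lemma integral_inv_geom (R : realType) (a delta : R) : 1 <= a -> 0 < delta ->
  (\int[lebesgue_measure]_(x in `[a, (expR delta * a)%R]) (x^-1)%:E = delta%:E)%E.
Proof.
move=> a1 delta0.
have a0 : 0 < a by exact: lt_le_trans a1.
have ab : a < expR delta * a by rewrite ltr_pMl // expR_gt1.
have cln x : a <= x -> {for x, continuous (@ln R)}.
  by move=> ax; apply: continuous_ln; exact: lt_le_trans ax.
rewrite (@continuous_FTC2 _ _ (@ln R)) //.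
- by rewrite lnM ?posrE ?expR_gt0 // expRK -EFinB addrK.
- apply: continuous_in_subspaceT => x; rewrite inE /= in_itv /= => /andP[ax _].
  by apply: inv_continuous; rewrite gt_eqF // (lt_le_trans a0).
- split.
  + move=> x; rewrite in_itv /= => /andP[ax _].
    by have [] := is_derive1_ln (lt_trans a0 ax).
  + exact/cvg_at_right_filter/cln.
  + exact/cvg_at_left_filter/cln/ltW.
- move=> x; rewrite in_itv /= => /andP[ax _].
  by rewrite derive1E; have [_ ->] := is_derive1_ln (lt_trans a0 ax).
Qed.

Lemma ge0_integral_subadd d (T : measurableType d) (R : realType)
    (mu : {measure set T -> \bar R}) (A B C : set T) (f : T -> \bar R) :
  measurable A -> measurable B -> measurable C ->
  measurable_fun A f -> measurable_fun B f ->
  (forall x, (A `|` B) x -> 0 <= f x)%E -> C `<=` A `|` B ->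
  (\int[mu]_(x in C) f x <= \int[mu]_(x in A) f x + \int[mu]_(x in B) f x)%E.
Proof.
move=> mA mB mC fA fB f0 CAB.
have mBA : measurable (B `\` A) by exact: measurableD.
have fAB : measurable_fun (A `|` B) f by exact/measurable_funU.
apply: (@le_trans _ _ (\int[mu]_(x in A `|` B) f x)%E).
  by apply: ge0_subset_integral => //; exact: measurableU.
have ABE : A `|` B = A `|` (B `\` A) by rewrite setUDr setDv setD0.
rewrite ABE ge0_integral_setU // -?ABE //; last by rewrite disj_set2E setDIK.
rewrite leeD2l //; apply: ge0_subset_integral => //.
by move=> x Bx; apply: f0; right.
Qed.

(** Induction on the number n of points wanted: y, the least point of E beyond
e^delta a, serves as the first one, and the others are sought beyond y. What E
has beyond a lies in [a, e^delta a], of logarithmic measure delta, or beyond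
y. *)
Lemma geom_points_or_small_log_measure (R : realType) (E : set R) (delta : R) (n : nat) (a : R) :
  closed E -> 0 < delta -> 1 <= a ->
  (exists x : nat -> R, [/\ expR delta * a <= x 0%N,
     geom_separated (expR delta) x & forall i, (i < n)%N -> E (x i)])
  \/ (\int[lebesgue_measure]_(x in E `&` [set x | (a <= x)%R]) (x^-1)%:E
        <= (n%:R * delta)%:E)%E.
Proof.
move=> cE delta0; set q := expR delta.
have q1 : 1 < q by rewrite /q expR_gt1.
have mE b : measurable (E `&` [set x | b <= x] : set R).
  by apply: closed_measurable; apply: closedI => //; exact: closed_ge.
have inv_ge0 (x : R) : 1 <= x -> (0 <= (x^-1)%:E)%E.
  by move=> x1; rewrite lee_fin invr_ge0 (le_trans ler01).
elim: n a => [|n IH] a a1.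
  left; exists (fun i => q ^+ i.+1 * a); split => //.
  by move=> i; rewrite mulrA -exprS.
have a0 : 0 < a by exact: lt_le_trans a1.
have qa : a <= q * a by rewrite ler_peMl // ltW.
have int_a : (\int[lebesgue_measure]_(x in `[a, (q * a)%R]) (x^-1)%:E = delta%:E)%E.
  exact: integral_inv_geom.
have itv1 x : x \in `[a, q * a] -> 1 <= x.
  by rewrite in_itv /= => /andP[+ _]; exact: le_trans.
have mitv := measurable_inv_ge1 (measurable_itv _) itv1.
have [[y [Ey /= y1]]|noy] := pselect (E `&` [set x | q * a <= x] !=set0); last first.
  right; apply: (@le_trans _ _ delta%:E).
    rewrite -int_a; apply: ge0_subset_integral => //; first exact: mE.
      by move=> x xI; apply: inv_ge0; exact: itv1.
    move=> x [Ex /= ax]; rewrite in_itv /= ax /= leNgt; apply/negP => qx.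
    by apply: noy; exists x; split => //=; exact: ltW.
  by rewrite lee_fin ler_peMl ?(ltW delta0) // ler1n.
have [] := @closed_has_min _ (E `&` [set x | q * a <= x]).
- by apply: closedI => //; exact: closed_ge.
- by exists y.
- by exists (q * a) => x [].
move=> {y Ey y1} y [Ey /= qay] ymin.
have y1 : 1 <= y by rewrite (le_trans a1) // (le_trans qa).
have [[x [qyx xq Ex]]|small] := IH _ y1; [left|right].
  exists (fun i => if i is i'.+1 then x i' else y); split => //; first by case.
  by case => // i; exact: Ex.
have Ey1 x : (E `&` [set x | y <= x]) x -> 1 <= x.
  by move=> [_ /=]; exact: le_trans.
have mEy := measurable_inv_ge1 (mE y) Ey1.
rewrite mulrSr mulrDl mul1r addrC EFinD.
apply: (@le_trans _ _ (\int[lebesgue_measure]_(x in `[a, (q * a)%R]) (x^-1)%:E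
  + \int[lebesgue_measure]_(x in E `&` [set x | (y <= x)%R]) (x^-1)%:E)%E).
  apply: ge0_integral_subadd => //; [exact: mE|exact: mE| |].
    by move=> x [xI|/Ey1]; apply: inv_ge0 => //; exact: itv1.
  move=> x [Ex /= ax]; have [xqa|qax] := leP x (q * a).
    by left; rewrite /= in_itv /= ax.
  by right; split => //=; apply: ymin; split => //=; exact: ltW.
by rewrite int_a leeD2l.
Qed.

(** * Consequences for the spread *)

(** For the first bound, multiply by s and use 1 + s <= 8 e^(s/8) to cancel the
exponential; for the second, 1 + 1/s <= 2 and take logarithms. *)
Lemma exp_growth_bounds (R : realType) (K s t : R) : 0 < K -> 0 < s -> 0 < t ->
  expR (s / 8) <= t * K * (1 + s^-1) ->
  s <= 8 * K * t /\ (1 <= s -> s <= 8 * (ln (2 * K) + ln t)).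
Proof.
move=> K0 s0 t0 h.
have tK0 : 0 < t * K by exact: mulr_gt0.
split=> [|s1].
  have e1 := expR_ge1Dx (s / 8).
  have e0 : 0 < expR (s / 8) by exact: expR_gt0.
  rewrite -(ler_pM2r e0).
  have : s * expR (s / 8) <= t * K * (1 + s).
    have := ler_wpM2l (ltW s0) h.
    by rewrite mulrCA mulrDr mulr1 mulfV ?gt_eqF // (addrC s).
  have : t * K * (1 + s) <= t * K * (8 * expR (s / 8)).
    by rewrite ler_wpM2l ?(ltW tK0) //; lra.
  lra.
have sV : s^-1 <= 1 by rewrite invf_le1.
have : expR (s / 8) <= 2 * K * t.
  apply: le_trans h _.
  have : t * K * (1 + s^-1) <= t * K * 2 by rewrite ler_wpM2l ?(ltW tK0) //; lra.
  lra.
rewrite -ler_ln ?posrE ?expR_gt0 ?mulr_gt0 // expRK.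
rewrite lnM ?posrE ?mulr_gt0 //; lra.
Qed.

Lemma max_top_coef_le (R : realType) (d : nat) (P : {poly R}) (B : R) : 0 <= B ->
  (forall k, (d < k.*2)%N -> `|P`_k| <= B) -> max_top_coef d P <= B.
Proof. by move=> B0 PB; apply: bigmax_le => // k; exact: PB. Qed.

(** The bound on the top coefficients, after taking d-th roots, for d + 1 points
with total logarithmic spread s, that is, with delta = s / (d + 1). *)
Lemma spread_points_bound (R : realType) (P : {poly R}) (alpha s : R) (x : nat -> R)
    (d : nat) : (0 < d)%N -> (size P <= d.+1)%N -> 0 < alpha -> 0 < s ->
  expR (s / d.+1%:R) <= x 0%N -> geom_separated (expR (s / d.+1%:R)) x ->
  (forall i, (i <= d)%N -> `|P.[x i]| <= alpha) -> 0 < max_top_coef d P ->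
  expR (s / 8) <= (alpha / max_top_coef d P) `^ d%:R^-1 * (16 * expR 2) * (1 + s^-1).
Proof.
move=> d0 sP alpha0 s0 xx0 xq Px; set M := max_top_coef d P => M0.
set t := _ `^ _.
have delta0 : 0 < s / d.+1%:R by rewrite divr_gt0.
have sE : d.+1%:R * (s / d.+1%:R) = s by rewrite mulrC divfK // pnatr_eq0.
pose A := 16 * expR 2 * (1 + s^-1) * expR (- (s / 8)).
have A0 : 0 < A.
  by rewrite !mulr_gt0 ?expR_gt0 // addr_gt0 // invr_gt0.
have MA : M <= alpha * A ^+ d.
  apply: max_top_coef_le => [|k dk].
    by rewrite mulr_ge0 ?exprn_ge0 ?(ltW alpha0) ?(ltW A0).
  have := top_coef_bound d0 sP dk delta0 xx0 xq Px.
  by rewrite sE.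
have t0 : 0 < t by rewrite powR_gt0 // divr_gt0.
have tX : t ^+ d = alpha / M.
  rewrite -powR_mulrn ?(ltW t0) // -powRrM mulVf ?pnatr_eq0 -?lt0n //.
  by rewrite powRr1 // divr_ge0 // ltW.
have tA : 1 <= t * A.
  rewrite leNgt; apply/negP => tA1.
  have : (t * A) ^+ d < 1 by rewrite exprn_ilt1 -?lt0n // mulr_ge0 // ltW.
  by rewrite exprMn tX mulrAC ltr_pdivrMr // mul1r ltNge MA.
have -> : t * (16 * expR 2) * (1 + s^-1) = t * A * expR (s / 8).
  by rewrite /A !mulrA -[RHS]mulrA -expRD addNr expR0 mulr1.
by rewrite ler_peMl // expR_ge0.
Qed.

Theorem lemma1p3 (R : realType) :
  exists c : R, 0 < c /\
    forall (d : nat) (P : {poly R}) (alpha : R),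
      (1 <= d)%N -> (size P <= d.+1)%N -> 0 < alpha ->
      let M := max_top_coef d P in
      0 < M ->
      (\int[lebesgue_measure]_(x in sublevel_ge1 P alpha) (x^-1)%:E
         <= (c * Num.min ((alpha / M) `^ (d%:R^-1))
                         (1 + d%:R^-1 * logp (alpha / M)))%:E)%E.
Proof.
pose K : R := 16 * expR 2.
have K1 : 1 <= K.
  have : 1 <= expR 2 :> R by rewrite -expR0 ler_expR.
  by rewrite /K; lra.
have K0 : 0 < K by exact: lt_le_trans K1.
(* Any constant above 16 K exceeds both of the bounds 8 K t and
   8 (ln (2 K) + L) <= 16 K (1 + L) on the spread s. *)
exists (16 * K + 1); split; first by rewrite addr_gt0 // mulr_gt0.
move=> d P alpha d1 sP alpha0 M M0.
set t := _ `^ _; set L := d%:R^-1 * _.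
have t0 : 0 < t by rewrite powR_gt0 // divr_gt0.
have L0 : 0 <= L by rewrite mulr_ge0 ?invr_ge0 // le_max lexx orbT.
have lnt : ln t <= L.
  by rewrite ln_powR /L ler_wpM2l ?invr_ge0 // le_max lexx.
set c := 16 * K + 1; set s := c * _.
have c0 : 0 < c by rewrite addr_gt0 // mulr_gt0.
have s0 : 0 < s by rewrite mulr_gt0 // lt_min t0 ltr_wpDr.
have delta0 : 0 < s / d.+1%:R by rewrite divr_gt0.
have cE : closed (sublevel_ge1 P alpha).
  have -> : sublevel_ge1 P alpha = [set x | 1 <= x] `&`
      (fun x => `|P.[x]|) @^-1` [set y | y <= alpha] by [].
  apply: closedI; first exact: closed_ge.
  apply: preimage_closed; last exact: closed_le.
  by move=> x _; apply: continuous_comp; [exact: continuous_horner|exact: norm_continuous].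
have [[x [xx0 xq Ex]]|] :=
    geom_points_or_small_log_measure d.+1 cE delta0 (lexx 1).
  exfalso.
  rewrite mulr1 in xx0.
  have Px i : (i <= d)%N -> `|P.[x i]| <= alpha by move=> /Ex[].
  have h := spread_points_bound d1 sP alpha0 s0 xx0 xq Px M0.
  have [sle sle1] := exp_growth_bounds K0 s0 t0 h.
  have := sle; have := sle1; rewrite /s /c.
  case: (leP t (1 + L)) => tL.
    move=> _; have := mulr_gt0 K0 t0; lra.
  have KL : 0 <= K * L by rewrite mulr_ge0 // ltW.
  have LK : L <= K * L by rewrite ler_peMl.
  have lnK : ln (2 * K) < 2 * K by rewrite ln_sublinear ?mulr_gt0.
  move=> /(_ _) H _; have : 1 <= (16 * K + 1) * (1 + L) by lra.
  move=> /H; lra.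
rewrite mulrC divfK ?pnatr_eq0 //.
by have -> : sublevel_ge1 P alpha `&` [set x | 1 <= x] = sublevel_ge1 P alpha
  by apply/setIidPl => y [].
Qed.
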